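(* Let $p \geqslant 7$ be an odd prime and let $d \geqslant 5$ be an integer. Then the graph $G_{p,d}$ is $3$-e.c. ($3$-existentially closed).
   Context: For an odd prime $p$, $\mathbb{Z}_p = \{0, 1, \ldots, p-1\}$ denotes the prime field with $p$ elements. The quadrance between points $X = (x_1, \ldots, x_d)$ and $Y = (y_1, \ldots, y_d)$ of $\mathbb{Z}_p^d$ is $Q(X,Y) := (x_1 - y_1)^2 + \cdots + (x_d - y_d)^2 \in \mathbb{Z}_p$. Let $V_1 = \{0, 1, 2, \ldots, (p-1)/2\} \subset \mathbb{Z}_p$ (residue classes of these integers). The graph $G_{p,d}$ is the (simple, undirected) graph whose vertices are the points of $\mathbb{Z}_p^d$, with an edge between two distinct vertices $X$ and $Y$ if and only if $Q(X,Y) \in V_1$. For a positive integer $n$, a graph with vertex set $V$ is $n$-e.c. ($n$-existentially closed) if for every pair of subsets $A, B \subseteq V$ such that $A \cap B = \emptyset$ and $|A| + |B| = n$ (either of $A$, $B$ may be empty), there is a vertex $z \in V$ not in $A \cup B$ that is joined to each vertex of $A$ and to no vertex of $B$. *)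

(* Defs.v *)
From HB Require Import structures.
From mathcomp Require Import all_boot all_order all_algebra.
Set Implicit Arguments.
Unset Strict Implicit.
Unset Printing Implicit Defensive.
Import GRing.Theory.
Local Open Scope ring_scope.

Definition quadrance (p d : nat) (X Y : 'rV['F_p]_d) : 'F_p :=
  \sum_(i < d) (X 0 i - Y 0 i) ^+ 2.

(* Residue classes of the integers 0, 1, ..., (p - 1) / 2. *)
Definition V1 (p : nat) : {set 'F_p} :=
  [set (k : nat)%:R | k : 'I_(p.-1./2).+1].

Definition G (p d : nat) : rel 'rV['F_p]_d :=
  fun X Y => (X != Y) && (quadrance X Y \in V1 p).

Lemma G_sym (p d : nat) : symmetric (@G p d).
Proof.
move=> X Y; rewrite /G eq_sym; congr (_ && (_ \in V1 p)).
by rewrite /quadrance; apply: eq_bigr => i _; rewrite -sqrrN opprB.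
Qed.

Lemma G_irr (p d : nat) : irreflexive (@G p d).
Proof. by move=> X; rewrite /G eqxx. Qed.

(* [e] is the adjacency relation of a graph with vertex type [T]. *)
Definition existentially_closed (n : nat) (T : finType) (e : rel T) : Prop :=
  forall A B : {set T},
    A :&: B = set0 -> (#|A| + #|B|)%N = n ->
    exists z : T,
      [/\ z \notin A :|: B,
          forall a, a \in A -> e z a
        & forall b, b \in B -> ~~ e z b].

(* Main.v *)
(** Translate the three given points to 0, u, v and look for z with z.z, (z-u).(z-u)
and (z-v).(z-v) in prescribed halves {1..m}, {m+1..2m} of the nonzero residues, p = 2m+1;
as 0 is left out, z automatically avoids the three points.
If u and v are independent, z.u, z.v and z.z can be prescribed at will: unless u and v span a
totally isotropic plane, their orthogonal complement contains two orthogonal anisotropic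
vectors, and a nondegenerate binary form over F_p represents everything; if they do span one,
move along u instead, which changes z.z as soon as z.u <> 0.
If v = t u, then z.u and z.z can still be prescribed, and the third distance is
(1-t) q1 + t q2 + t(t-1) u.u, where q1, q2 are the first two.  By Cauchy-Davenport for
arithmetic progressions this takes at least p-2 values as q1, q2 vary, hence meets the
third half, which has m >= 3 elements. *)

Require Import Defs.
From mathcomp Require Import all_boot all_order all_algebra.
From mathcomp Require Import ring zify.
Set Implicit Arguments.
Unset Strict Implicit.
Unset Printing Implicit Defensive.
Import GRing.Theory.
Local Open Scope ring_scope.

(** * The standard bilinear form and orthogonal complements over a field *)

Section Dot.
Variables (F : fieldType) (d : nat).
Implicit Types u v w z : 'rV[F]_d.

Definition dot u v : F := (u *m v^T) 0 0.

Lemma dotC u v : dot u v = dot v u.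
Proof. by rewrite /dot -[v in RHS]trmxK -trmx_mul [RHS]mxE. Qed.

Lemma dotDl u v w : dot (u + v) w = dot u w + dot v w.
Proof. by rewrite /dot mulmxDl mxE. Qed.

Lemma dotZl a u w : dot (a *: u) w = a * dot u w.
Proof. by rewrite /dot -scalemxAl mxE. Qed.

Lemma dotDr u v w : dot w (u + v) = dot w u + dot w v.
Proof. by rewrite dotC dotDl !(dotC w). Qed.

Lemma dotZr a u w : dot w (a *: u) = a * dot w u.
Proof. by rewrite dotC dotZl (dotC w). Qed.

Lemma dotNl u w : dot (- u) w = - dot u w.
Proof. by rewrite -scaleN1r dotZl mulN1r. Qed.

Lemma dotNr u w : dot w (- u) = - dot w u.
Proof. by rewrite dotC dotNl dotC. Qed.

Definition dotE := (dotDl, dotDr, dotZl, dotZr, dotNl, dotNr).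

Lemma mulmx_tr_rowE m n (A : 'M[F]_(m, d)) (B : 'M[F]_(n, d)) i j :
  (A *m B^T) i j = dot (row i A) (row j B).
Proof. by rewrite /dot !mxE; apply: eq_bigr => k _; rewrite !mxE. Qed.

(** Polarization: if two rows are isotropic but not orthogonal, their sum has norm twice their
    product. *)
Lemma anisotropic_row m (W : 'M[F]_(m, d)) :
  (2%:R : F) != 0 -> W *m W^T != 0 ->
  exists2 w, (w <= W)%MS & dot w w != 0.
Proof.
move=> two_neq0 /matrix0Pn [i [j]]; rewrite mulmx_tr_rowE => nz.
have [ii0|] := eqVneq (dot (row i W) (row i W)) 0; last first.
  by exists (row i W) => //; apply: row_sub.
have [jj0|] := eqVneq (dot (row j W) (row j W)) 0; last first.
  by exists (row j W) => //; apply: row_sub.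
exists (row i W + row j W); first by apply: addmx_sub; apply: row_sub.
rewrite !dotE ii0 jj0 (dotC (row j W)) add0r addr0 -mulr2n -mulr_natl.
by rewrite mulf_neq0.
Qed.

(** [kermx N^T] is the orthogonal complement of the row space of [N]. The double complement contains
    that space, and both have the same rank. *)
Lemma ker_ker_sub m (N : 'M[F]_(m, d)) :
  (kermx (kermx N^T)^T <= N)%MS.
Proof.
have sub : (N <= kermx (kermx N^T)^T)%MS.
  by apply/sub_kermxP; rewrite -[N]trmxK -trmx_mul trmxK mulmx_ker trmx0.
have := rank_leq_col N.
move: (mxrank_leqif_sup sub) => /leqifP; case: ifP => // _.
rewrite !mxrank_ker !mxrank_tr !mxrank_ker mxrank_tr; lia.
Qed.

Lemma isotropic_ker_sub m (N : 'M[F]_(m, d)) (W := kermx N^T) :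
  W *m W^T = 0 -> (W <= N)%MS.
Proof. by move=> /sub_kermxP h; apply: submx_trans h (ker_ker_sub N). Qed.

(** With r the rank of [N], the complement has dimension d - r > r, too large to be totally
    isotropic, whence [w1]. If the complement of [N] and [w1] were totally isotropic, it would lie
    in [N] and have dimension at least d - r - 1, hence equal [N]. Then d = 2r + 1 and [N] is
    totally isotropic, which the last hypothesis excludes. *)
Lemma anisotropic_pair m (N : 'M[F]_(m, d)) :
  (2%:R : F) != 0 -> ((\rank N).*2 < d)%N ->
  ((\rank N).*2.+1 < d)%N || (N *m N^T != 0) ->
  exists w1 w2, [/\ N *m w1^T = 0, N *m w2^T = 0, dot w1 w2 = 0,
    dot w1 w1 != 0 & dot w2 w2 != 0].
Proof.
move=> two_neq0 rkN nondeg.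
have perpP l (w : 'M[F]_(l, d)) k (M : 'M[F]_(k, d)) :
    (w <= kermx M^T)%MS -> M *m w^T = 0.
  by move=> /sub_kermxP h; rewrite -[M]trmxK -trmx_mul h trmx0.
have [|w1 w1N w1n] := anisotropic_row (W := kermx N^T) two_neq0.
  apply/eqP => /isotropic_ker_sub /mxrankS; rewrite mxrank_ker mxrank_tr; lia.
pose N' := col_mx N w1; pose W' := kermx N'^T.
have Nw1 := perpP _ _ _ _ w1N.
have [W'0|] := eqVneq (W' *m W'^T) 0; last first.
  move=> /(anisotropic_row two_neq0)[w2 /perpP + w2n].
  rewrite /N' mul_col_mx => /eqP; rewrite col_mx_eq0 => /andP[/eqP Nw2 /eqP w12].
  by exists w1, w2; split=> //; rewrite /dot w12 mxE.
(* W' lies in the span of N and w1; being orthogonal to w1, which is itself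
   orthogonal to N and anisotropic, it has no component along w1. *)
have W'N : (W' <= N)%MS.
  have /submxP[D W'E] : (W' <= N')%MS by apply: isotropic_ker_sub.
  move: (W'E); rewrite -[D]hsubmxK mul_row_col => W'E2.
  have : W' *m w1^T = 0.
    have := mulmx_ker N'^T; rewrite -/W' /N' tr_col_mx mul_mx_row.
    by move=> /eqP; rewrite row_mx_eq0 => /andP[_ /eqP].
  rewrite W'E2 mulmxDl -!mulmxA Nw1 mulmx0 add0r.
  rewrite [w1 *m _]mx11_scalar -/(dot w1 w1) mul_mx_scalar => /eqP.
  rewrite scaler_eq0 (negPf w1n) /= => /eqP ->.
  by rewrite mul0mx addr0 submxMl.
have rkN' : (\rank N' <= (\rank N).+1)%N.
  rewrite /N' -addsmxE; apply: leq_trans (mxrank_adds_leqif _ _) _.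
  by have := rank_leq_row w1; lia.
have rkW' : (d <= \rank W' + (\rank N).+1)%N.
  rewrite mxrank_ker mxrank_tr; have := rank_leq_col N'; lia.
have := mxrankS W'N => rkle.
have rkE : \rank W' = \rank N by lia.
have NW' : (N <= W')%MS by rewrite -(mxrank_leqif_sup W'N) rkE.
case/orP: nondeg => [|/eqP[]]; first lia.
have := perpP _ _ _ _ NW'; rewrite /N' mul_col_mx => /eqP.
by rewrite col_mx_eq0 => /andP[/eqP].
Qed.

End Dot.

(** * Sumsets, binary forms and halves of the residues in ['F_p] *)

Section PrimeField.
Variable p : nat.
Hypothesis p_prime : prime p.
Implicit Types (a b c g t x y : 'F_p) (X Y : {set 'F_p}).

Lemma eq_natr_Fp i j : (i < p)%N -> (j < p)%N ->
  (i%:R == j%:R :> 'F_p) = (i == j).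
Proof.
move=> ip jp; apply/eqP/eqP => [|->] // /(congr1 val).
by rewrite /= !val_Fp_nat // !modn_small.
Qed.

Lemma natr_FpK x : (x : nat)%:R = x.
Proof.
apply: val_inj; rewrite /= val_Fp_nat // modn_small //.
by have := ltn_ord x; rewrite [in X in (_ < X)%N]Fp_cast.
Qed.

(** The sumset Y + {0, r}, so that the k-th iterate is Y + {0, r, ..., kr}. *)
Definition shift_union r Y := Y :|: [set y + r | y in Y].

(** A nonempty set stable under translation by [r] is everything, as [r] generates the additive
    group. *)
Lemma leq_card_shift_union r Y : r != 0 -> Y != set0 ->
  (minn p #|Y|.+1 <= #|shift_union r Y|)%N.
Proof.
move=> r_neq0 /set0Pn [y0 y0Y]; rewrite geq_min.
have [closed|/subsetPn[z zr zY]] := boolP ([set y + r | y in Y] \subset Y).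
  suff -> : Y = setT by rewrite /shift_union setTU cardsT card_Fp // leqnn.
  have stepY k : y0 + k%:R * r \in Y.
    elim: k => [|k IHk]; first by rewrite mul0r addr0.
    rewrite -natr1 mulrDl mul1r addrA.
    by apply: (subsetP closed); apply: imset_f.
  apply/setP => z; rewrite inE.
  by have := stepY ((z - y0) / r); rewrite natr_FpK divfK // addrC subrK => ->.
apply/orP; right; apply: proper_card; rewrite properE subsetUl /=.
by apply/subsetPn; exists z => //; rewrite inE zr orbT.
Qed.

Lemma leq_card_iter_shift_union r X k : r != 0 -> X != set0 ->
  (minn p (#|X| + k) <= #|iter k (shift_union r) X|)%N.
Proof.
move=> r_neq0 X_neq0; elim: k => [|k IHk]; first by rewrite addn0 geq_minr.
have := leq_card_shift_union r_neq0 (Y := iter k (shift_union r) X).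
rewrite -card_gt0 iterS; move: IHk X_neq0 (prime_gt0 p_prime).
rewrite -card_gt0; lia.
Qed.

Lemma iter_shift_unionP r X k y : y \in iter k (shift_union r) X ->
  exists i x, [/\ (i <= k)%N, x \in X & y = x + i%:R * r].
Proof.
elim: k y => [|k IHk] y /=; first by exists 0%N, y; rewrite mul0r addr0.
rewrite inE => /orP[/IHk[i [x [ik xX ->]]]|].
  by exists i, x; split=> //; apply: leqW.
move=> /imsetP[z /IHk[i [x [ik xX ->]]] ->].
by exists i.+1, x; split=> //; rewrite -natr1; ring.
Qed.

Hypothesis p_odd : odd p.

Lemma Fp_two_neq0 : 2%:R != 0 :> 'F_p.
Proof.
have := prime_gt1 p_prime => p_gt1.
by rewrite (@eq_natr_Fp 2 0) //; lia.
Qed.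

(** Pigeonhole: for x and y in {0, ..., (p-1)/2}, the values of a x^2 are distinct, and so are those
    of c - b y^2. These are p + 1 values in all, so the two families meet. *)
Lemma sum_two_squares a b c : a != 0 -> b != 0 ->
  exists x y, a * x ^+ 2 + b * y ^+ 2 = c.
Proof.
move=> a_neq0 b_neq0; pose m := p./2.
have sqr_inj (i j : 'I_m.+1) : (i%:R : 'F_p) ^+ 2 = j%:R ^+ 2 -> i = j.
  have := prime_gt1 p_prime; have := ltn_ord i; have := ltn_ord j => im jm p1.
  move=> /eqP; rewrite eqf_sqr -addr_eq0 -natrD (@eq_natr_Fp _ 0); try lia.
  rewrite eq_natr_Fp; try lia.
  by move=> ij; apply: ord_inj; lia.
pose f (s : 'I_m.+1 + 'I_m.+1) : 'F_p :=
  match s with inl i => a * i%:R ^+ 2 | inr j => c - b * j%:R ^+ 2 end.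
have /injectivePn[s [s' ss']] : ~~ injectiveb f.
  apply/negP => /injectiveP /leq_card.
  by rewrite card_sum card_Fp // !card_ord; lia.
case: s s' ss' => [i|i] [j|j] ij /=.
- by move=> /(mulfI a_neq0) /sqr_inj ijE; rewrite ijE eqxx in ij.
- by move=> fij; exists i%:R, j%:R; rewrite fij subrK.
- by move=> fij; exists j%:R, i%:R; rewrite -fij subrK.
- move=> /addrI /oppr_inj /(mulfI b_neq0) /sqr_inj ijE.
  by rewrite ijE eqxx in ij.
Qed.

(* [half true] is [V1] without 0 and [half false] is the complement of [V1]. *)
Definition half_elt (s : bool) k : 'F_p :=
  (if s then k.+1 else (p./2 + k).+1)%:R.

Definition half s : {set 'F_p} := [set half_elt s k | k : 'I_(p./2)].

Lemma half_elt_in s k : (k < p./2)%N -> half_elt s k \in half s.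
Proof. by move=> kp; apply/imsetP; exists (Ordinal kp). Qed.

Lemma card_half s : #|half s| = p./2.
Proof.
rewrite card_imset ?card_ord // => i j /eqP.
have := ltn_ord i; have := ltn_ord j => im jm.
rewrite /half_elt; case: s; rewrite eq_natr_Fp; try lia.
all: by move=> ij; apply: ord_inj; lia.
Qed.

Lemma half_neq0 s x : x \in half s -> x != 0.
Proof.
move=> /imsetP[k _ ->]; have := ltn_ord k => km.
by rewrite /half_elt; case: s; rewrite (@eq_natr_Fp _ 0); lia.
Qed.

Lemma half_V1 s x : x \in half s -> (x \in V1 p) = s.
Proof.
move=> /imsetP[k _ ->]; have := ltn_ord k => km; rewrite /half_elt.
case: s; last apply/negP.
  have kp : (k.+1 < (p.-1./2).+1)%N by lia.
  by apply/imsetP; exists (Ordinal kp).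
move=> /imsetP[j _ /eqP]; have := ltn_ord j => jm.
by rewrite eq_natr_Fp; lia.
Qed.

Hypothesis p_ge7 : (7 <= p)%N.

Lemma half_affine_combination s1 s2 s3 t c : t != 0 -> t != 1 ->
  exists x1 x2, [/\ x1 \in half s1, x2 \in half s2 &
    (1 - t) * x1 + t * x2 + c \in half s3].
Proof.
move=> t_neq0 t_neq1.
pose X := [set (1 - t) * x + t * half_elt s2 0 + c | x in half s1].
have cardX : #|X| = p./2.
  rewrite card_imset ?card_half // => x y /addIr /addIr.
  by apply: mulfI; rewrite subr_eq0 eq_sym.
have X_neq0 : X != set0 by rewrite -card_gt0 cardX; lia.
(* The second half is a progression of [p./2] terms with step 1, so [x2] runs over it in [(p./2).-1]
   shifts, each adding [t] to the combination. *)
pose Y := iter (p./2).-1 (shift_union t) X.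
have cardY : (p - 2 <= #|Y|)%N.
  have := leq_card_iter_shift_union (p./2).-1 t_neq0 X_neq0.
  by rewrite -/Y cardX; lia.
(* [Y] misses at most two residues, and [half s3] has at least three. *)
have /set0Pn[y] : Y :&: half s3 != set0.
  have := subset_leq_card (subsetT (Y :|: half s3)).
  rewrite cardsT card_Fp // -card_gt0.
  by have := cardsUI Y (half s3); rewrite card_half; lia.
rewrite inE => /andP[/iter_shift_unionP[i [_ [ip /imsetP[x1 x1H ->] ->]]] yH].
exists x1, (half_elt s2 i); split=> //; first by apply: half_elt_in; lia.
suff <- : (1 - t) * x1 + t * half_elt s2 0 + c + i%:R * t =
  (1 - t) * x1 + t * half_elt s2 i + c by [].
suff -> : half_elt s2 i = half_elt s2 0 + i%:R by ring.
by rewrite /half_elt -natrD; case: (s2); congr _%:R; lia.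
Qed.

Lemma half_neq s x : exists2 y, y \in half s & y != x.
Proof.
have /subsetPn[y yH] : ~~ (half s \subset [set x]).
  by apply/negP => /subset_leq_card; rewrite card_half cards1; lia.
by rewrite inE; exists y.
Qed.

Lemma mem_half s : exists x, x \in half s.
Proof. by exists (half_elt s 0); apply: half_elt_in; lia. Qed.

(** * Vectors with prescribed products, norms and distances *)

Variable d : nat.
Implicit Types u v w z : 'rV['F_p]_d.

Lemma sphere_meets_affine k (N : 'M['F_p]_(k, d)) z0 g :
  ((\rank N).*2 < d)%N -> ((\rank N).*2.+1 < d)%N || (N *m N^T != 0) ->
  exists2 z, N *m z^T = N *m z0^T & dot z z = g.
Proof.
move=> rkN nondeg.
have [w1 [w2 [Nw1 Nw2 w12 w1n w2n]]] :=
  anisotropic_pair Fp_two_neq0 rkN nondeg.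
(* The coordinates of [z0] along [w1] and [w2]. Completing the squares leaves a diagonal binary form
   in x and y to solve. *)
pose l1 := dot z0 w1 / dot w1 w1; pose l2 := dot z0 w2 / dot w2 w2.
have [x [y xy]] := sum_two_squares
  (g - dot z0 z0 + l1 ^+ 2 * dot w1 w1 + l2 ^+ 2 * dot w2 w2) w1n w2n.
exists (z0 + (x - l1) *: w1 + (y - l2) *: w2).
  rewrite !linearD !linearZ /= Nw1 Nw2.
  by rewrite !scaler0 !addr0.
rewrite !dotE (dotC w1 z0) (dotC w2 z0) (dotC w2 w1) w12.
rewrite -[dot z0 w1](divfK w1n) -[dot z0 w2](divfK w2n) -/l1 -/l2.
transitivity (dot w1 w1 * x ^+ 2 + dot w2 w2 * y ^+ 2 +
  (dot z0 z0 - l1 ^+ 2 * dot w1 w1 - l2 ^+ 2 * dot w2 w2)); first by ring.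
by rewrite xy; ring.
Qed.

Lemma row_free_solve k (N : 'M['F_p]_(k, d)) (c : 'cV['F_p]_k) :
  row_free N -> exists z, N *m z^T = c.
Proof.
move=> N_free; exists (pinvmx N *m c)^T.
by rewrite trmxK mulmxA mulmxVp // mul1mx.
Qed.

Lemma dot_norm_prescribed u a g : (4 <= d)%N -> u != 0 ->
  exists2 z, dot u z = a & dot z z = g.
Proof.
move=> d_ge4 u_neq0; have rku : \rank u = 1%N by rewrite rank_rV u_neq0.
have [z0 z0E] : exists z, u *m z^T = a%:M.
  by apply: row_free_solve; rewrite /row_free rku.
have rk1 : ((\rank u).*2.+1 < d)%N by rewrite rku.
have [|z zE zg] := sphere_meets_affine z0 g (ltnW rk1); first by rewrite rk1.
by exists z => //; rewrite /dot zE z0E mxE.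
Qed.

Lemma dot_dot_norm_prescribed u v a b g : (5 <= d)%N ->
  row_free (col_mx u v) ->
  (dot u u = 0 -> dot v u = 0 -> a != 0) ->
  exists z, [/\ dot u z = a, dot v z = b & dot z z = g].
Proof.
move=> d_ge5 uv_free a_neq0; set N := col_mx u v in uv_free.
have [z0] := row_free_solve (col_mx a%:M b%:M) uv_free.
have NE z : N *m z^T = col_mx (dot u z)%:M (dot v z)%:M.
  by rewrite mul_col_mx [u *m _]mx11_scalar [v *m _]mx11_scalar.
have NI z a' b' : N *m z^T = col_mx a'%:M b'%:M -> dot u z = a' /\ dot v z = b'.
  rewrite NE => /eq_col_mx[/matrixP/(_ 0 0) + /matrixP/(_ 0 0)].
  by rewrite !mxE.
move=> z0E; have rkN : \rank N = 2 by apply/eqP.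
(* When d = 5 the rank alone does not provide the pair of anisotropic vectors, so the totally
   isotropic plane is treated apart. *)
have [NN|NN] := eqVneq (N *m N^T) 0; last first.
  have [||z zE zg] := sphere_meets_affine (N := N) z0 g.
  - by rewrite rkN.
  - by rewrite NN orbT.
  by rewrite z0E in zE; have [] := NI _ _ _ zE; exists z.
have [uz0 vz0] := NI _ _ _ z0E.
have : N *m u^T = col_mx 0%:M 0%:M.
  rewrite raddf0 col_mx0; move: NN; rewrite {2}/N tr_col_mx mul_mx_row => /eqP.
  by rewrite row_mx_eq0 => /andP[/eqP].
move=> /NI [uu vu]; have {}a_neq0 := a_neq0 uu vu.
have two_neq0 := Fp_two_neq0.
(* As [u] is orthogonal to itself and to [v], adding c [u] preserves both products and changes the
   norm by 2ca. *)
exists (z0 + ((g - dot z0 z0) / (2%:R * a)) *: u).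
rewrite !dotE (dotC z0 u) uz0 vz0 uu vu; split; try ring.
by field; apply/andP.
Qed.

Lemma half_distances u v s1 s2 s3 : (5 <= d)%N -> u != 0 -> v != 0 -> u != v ->
  exists z, [/\ dot z z \in half s1, dot (z - u) (z - u) \in half s2
    & dot (z - v) (z - v) \in half s3].
Proof.
move=> d_ge5 u_neq0 v_neq0 uv; have two_neq0 := Fp_two_neq0.
have distE w z : dot (z - w) (z - w) = dot z z - 2%:R * dot w z + dot w w.
  by rewrite !dotE (dotC z w); ring.
have [uv_free|uv_dep] := boolP (row_free (col_mx u v)).
  have [q1 q1H] := mem_half s1; have [q3 q3H] := mem_half s3.
  (* The product of [u] and [z] must be (q1 - q2 + u.u) / 2. Taking q2 different from q1 makes it
     nonzero when [u] is isotropic. *)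
  have [q2 q2H q21] := half_neq s2 q1.
  have [|z [uz vz zz]] := dot_dot_norm_prescribed
    (a := (q1 - q2 + dot u u) / 2%:R) ((q1 - q3 + dot v v) / 2%:R) q1 d_ge5 uv_free.
    by move=> -> _; rewrite addr0 mulf_neq0 ?invr_eq0 // subr_eq0 eq_sym.
  exists z; rewrite !distE uz vz zz; split=> //.
  - by rewrite [X in X \in _](_ : _ = q2) //; field.
  - by rewrite [X in X \in _](_ : _ = q3) //; field.
have [t vE] : exists t, v = t *: u.
  apply/sub_rVP; have uN : (u <= col_mx u v)%MS by rewrite -addsmxE addsmxSl.
  have vN : (v <= col_mx u v)%MS by rewrite -addsmxE addsmxSr.
  apply: submx_trans vN _; rewrite -(mxrank_leqif_sup uN) rank_rV u_neq0.
  have := rank_leq_row (col_mx u v); have := mxrankS uN; rewrite rank_rV u_neq0.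
  by move: uv_dep; rewrite /row_free; lia.
have t_neq0 : t != 0 by apply: contraNneq v_neq0 => t0; rewrite vE t0 scale0r.
have t_neq1 : t != 1 by apply: contraNneq uv => t1; rewrite vE t1 scale1r.
have [q1 [q2 [q1H q2H q3H]]] := half_affine_combination s1 s2 s3
  (t * (t - 1) * dot u u) t_neq0 t_neq1.
have [|z uz zz] := dot_norm_prescribed ((q1 - q2 + dot u u) / 2%:R) q1 _ u_neq0.
  by apply: leq_trans d_ge5.
exists z; rewrite !distE vE !dotE uz zz; split=> //.
  by rewrite [X in X \in _](_ : _ = q2) //; field.
rewrite [X in X \in _](_ : _ = (1 - t) * q1 + t * q2 + t * (t - 1) * dot u u) //.
by field.
Qed.

(** * From distances to adjacency *)

Lemma quadranceE z w : quadrance z w = dot (z - w) (z - w).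
Proof.
by rewrite /quadrance /dot mxE; apply: eq_bigr => i _; rewrite !mxE expr2.
Qed.

Lemma prescribed_adjacency P1 P2 P3 s1 s2 s3 : (5 <= d)%N ->
  P1 != P2 -> P1 != P3 -> P2 != P3 ->
  exists z, [/\ z != P1, z != P2 & z != P3] /\
    [/\ G z P1 = s1, G z P2 = s2 & G z P3 = s3].
Proof.
move=> d_ge5 P12 P13 P23.
have GE s z w : dot (z - w) (z - w) \in half s -> z != w /\ G z w = s.
  move=> h; have zw : z != w.
    apply: contraTneq h => ->; rewrite subrr /dot mul0mx mxE.
    by apply/negP => /half_neq0; rewrite eqxx.
  by rewrite /G zw quadranceE (half_V1 h).
have [||| z [z1 z2 z3]] := half_distances (u := P2 - P1) (v := P3 - P1) s1 s2 s3 d_ge5.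
- by rewrite subr_eq0 eq_sym.
- by rewrite subr_eq0 eq_sym.
- by rewrite (inj_eq (addIr _)).
have P1E : P1 + z - P1 = z by rewrite addrC addKr.
have shiftE P : P1 + z - P = z - (P - P1) by rewrite opprB [RHS]addrCA addrA.
rewrite -P1E in z1; rewrite -shiftE in z2; rewrite -shiftE in z3.
have [n1 G1] := GE _ _ _ z1; have [n2 G2] := GE _ _ _ z2.
by have [n3 G3] := GE _ _ _ z3; exists (P1 + z).
Qed.

End PrimeField.

Local Close Scope ring_scope.

Theorem theorem1p2 (p d : nat) (p_prime : prime p) (p_odd : odd p)
    (p_ge7 : 7 <= p) (d_ge5 : 5 <= d) :
  existentially_closed 3 (@G p d).
Proof.
move=> A B AB0 cardAB.
have : #|A :|: B| = 3 by rewrite cardsU AB0 cards0 subn0.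
have := mem_enum (A :|: B); have := enum_uniq (A :|: B); rewrite cardE.
case: (enum _) => [|P1 [|P2 [|P3 [|]]]] //=; rewrite !inE negb_or andbT.
move=> /andP[/andP[P12 P13] P23] ABE _.
(* Each of the three points of the union asks for adjacency exactly when it lies in [A]; by
   disjointness, points of [B] ask for non-adjacency. *)
have [z [[z1 z2 z3] [G1 G2 G3]]] := prescribed_adjacency p_prime p_odd p_ge7
  (P1 \in A) (P2 \in A) (P3 \in A) d_ge5 P12 P13 P23.
have Gz P : P \in A :|: B -> G z P = (P \in A).
  by rewrite -ABE !inE => /or3P[] /eqP ->.
exists z; split.
- by rewrite -ABE !inE !negb_or z1 z2 z3.
- by move=> a aA; rewrite Gz // inE aA.
move=> b bB; rewrite Gz ?inE ?bB ?orbT //; apply/negP => bA.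
by have /setP/(_ b) := AB0; rewrite !inE bA bB.
Qed.
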